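(* Let $\mathbb{F}=\mathbb{R}$ or $\mathbb{C}$, and set $\alpha=1$ if $\mathbb{F}=\mathbb{R}$ and $\alpha=2$ if $\mathbb{F}=\mathbb{C}$. Let $n\ge1$, let $\mathcal{S}\subseteq\mathcal{S}'\subseteq\mathbb{F}^n$ be linear subspaces, let $p=\dim(\mathcal{S})$ and $q=\dim(\mathcal{S}')-\dim(\mathcal{S})$, and assume $q\le p$. Let $\mathcal{M}(\mathcal{S},\mathcal{S}'):=\{A\in\mathbb{F}^{n\times n}:\mathcal{S}+A\mathcal{S}=\mathcal{S}'\}$ and $\mathcal{M}_{\mathrm{inv}}(\mathcal{S},\mathcal{S}'):=\mathcal{M}(\mathcal{S},\mathcal{S}')\cap\mathrm{GL}(n)$. Then: (i) $\mathcal{M}_{\mathrm{inv}}(\mathcal{S},\mathcal{S}')$ is a smooth embedded submanifold of $\mathrm{GL}(n)$ of dimension $\alpha\,(n^2-p(n-p-q))$. (ii) $\mathcal{M}_{\mathrm{inv}}(\mathcal{S},\mathcal{S}')$ is an open, dense subset of $\mathcal{M}(\mathcal{S},\mathcal{S}')$.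
   Context: $A\mathcal{S}=\{Ax:x\in\mathcal{S}\}$. $\mathrm{GL}(n)$ is the set of invertible matrices in $\mathbb{F}^{n\times n}$. $\mathbb{R}^{n\times n}$ and $\mathbb{C}^{n\times n}$ are identified with the smooth real manifolds $\mathbb{R}^{n^2}$ and $\mathbb{R}^{2n^2}$ respectively, $\mathrm{GL}(n)$ is an open submanifold, and all sets of matrices carry the subset topology. ''Manifold'' and ''dimension'' refer to real smooth manifolds. *)

(* Defs.v *)
From HB Require Import structures.
From mathcomp Require Import all_boot all_order all_algebra.
From mathcomp Require Import all_classical all_reals all_analysis.
From mathcomp Require Import complex.
Import Order.TTheory GRing.Theory Num.Theory numFieldNormedType.Exports.

Set Implicit Arguments.
Unset Strict Implicit.
Unset Printing Implicit Defensive.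

Local Open Scope classical_set_scope.
Local Open Scope ring_scope.

Section Smooth.
Variable R : realType.

(* Only meaningful for U open, where continuity and derivatives at the points
   of U depend on the restriction of f to U alone. *)
Fixpoint Ck (k : nat) {N m : nat} (U : set 'rV[R]_N)
    (f : 'rV[R]_N -> 'rV[R]_m) : Prop :=
  {in U, continuous f} /\
  if k is k'.+1 then
    forall i : 'I_N,
      {in U, forall x, derivable f x (delta_mx 0 i)} /\
      Ck k' U (fun x => 'D_(delta_mx 0 i) f x)
  else True.

Definition smooth_on {N m : nat} (U : set 'rV[R]_N)
    (f : 'rV[R]_N -> 'rV[R]_m) : Prop :=
  forall k, Ck k U f.

Definition diffeomorphism {N : nat} (U V : set 'rV[R]_N)
    (phi : 'rV[R]_N -> 'rV[R]_N) : Prop :=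
  [/\ set_bij U V phi,
      smooth_on U phi
    & exists psi : 'rV[R]_N -> 'rV[R]_N,
        {in U, cancel phi psi} /\ smooth_on V psi].

(* R^d x {0} inside R^N, for d <= N. *)
Definition coordinate_slice {N : nat} (d : nat) : set 'rV[R]_N :=
  [set y | forall i : 'I_N, (d <= i)%N -> y 0 i = 0].

(* For W open in R^N, seen as an open submanifold of R^N: M is a
   d-dimensional embedded submanifold of W when every point of M lies in the
   domain of a slice chart of W for M. *)
Definition embedded_submanifold {N : nat} (W : set 'rV[R]_N) (d : nat)
    (M : set 'rV[R]_N) : Prop :=
  [/\ (d <= N)%N, M `<=` W
    & forall x, M x ->
      exists (U V : set 'rV[R]_N) (phi : 'rV[R]_N -> 'rV[R]_N),
        [/\ open U /\ U `<=` W, U x, open V, diffeomorphism U V phi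
          & phi @` (U `&` M) = V `&` coordinate_slice d]].

End Smooth.

Definition open_subset_of {T : topologicalType} (X A : set T) : Prop :=
  exists2 O : set T, open O & A = X `&` O.

Definition dense_subset_of {T : topologicalType} (X A : set T) : Prop :=
  A `<=` X /\ X `<=` closure A.

Variant ground := RealField | ComplexField.

Definition ground_field (R : realType) (g : ground) : fieldType :=
  match g with
  | RealField => R
  | ComplexField => R[i]
  end.

Definition alpha (g : ground) : nat :=
  match g with RealField => 1%N | ComplexField => 2%N end.

(* Equal to alpha g * n ^ 2, in the form computed by [mxvec] and [row_mx]. *)
Definition real_size (g : ground) (n : nat) : nat :=
  match g with
  | RealField => (n * n)%N
  | ComplexField => (n * n + n * n)%N
  end.

Definition real_coords {R : realType} {g : ground} {n : nat} :
    'M[ground_field R g]_n -> 'rV[R]_(real_size g n) :=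
  match g return 'M[ground_field R g]_n -> 'rV[R]_(real_size g n) with
  | RealField => fun A => mxvec A
  | ComplexField => fun A =>
      row_mx (mxvec (map_mx (@complex.Re R) A))
             (mxvec (map_mx (@complex.Im R) A))
  end.

Definition GL {F : fieldType} {n : nat} : set 'M[F]_n :=
  [set A | A \in unitmx].

Section MatrixSets.
Variables (F : fieldType) (n : nat).
Implicit Types S : {vspace 'cV[F]_n}.

Definition mx_image (A : 'M[F]_n) S : {vspace 'cV[F]_n} :=
  (linfun (mulmx A : 'cV[F]_n -> 'cV[F]_n) @: S)%VS.

Definition Mset S S' : set 'M[F]_n :=
  [set A | (S + mx_image A S)%VS = S'].

Definition Minv S S' : set 'M[F]_n := Mset S S' `&` GL.

End MatrixSets.

(* Main.v *)
(* M(S, S') is the intersection of the linear space K = {A | A S <= S'} with an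
   open set: writing S as the image of B and S' as the kernel of C, K is
   {A | C A B = 0}, of codimension p (n - p - q) over F, and near a point of
   M(S, S') no further condition is imposed. After identification with real
   coordinates, a linear change of coordinates straightens K into a coordinate
   slice. For density, S + (A - t I) S = S + A S, and A - t I is invertible for
   all t but the eigenvalues of A. *)
Require Import Defs.
From HB Require Import structures.
From mathcomp Require Import all_boot all_order all_algebra.
From mathcomp Require Import all_classical all_reals all_analysis.
From mathcomp Require Import complex.
Import Order.TTheory GRing.Theory Num.Theory.
Import numFieldNormedType.Exports.

Set Implicit Arguments.
Unset Strict Implicit.
Unset Printing Implicit Defensive.

Local Open Scope classical_set_scope.
Local Open Scope ring_scope.

(** * Linear changes of coordinates as slice charts *)

Section LinearCharts.
Variable R : realType.

(** A neighbourhood of a matrix contains a product of neighbourhoods of its entries, and finitely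
    many conditions holding near a point hold near it jointly. *)
Lemma continuous_mx_entries (T : topologicalType) m n (f : T -> 'M[R]_(m, n)) :
  (forall i j, continuous (fun x => f x i j)) -> continuous f.
Proof.
move=> cf x A [P nP sPA].
have : \forall y \near x, forall i j, P i j (f y i j).
  apply: filter_forall => i; apply: filter_forall => j.
  exact: (cf i j x) (nP i j).
by apply: filterS => y Py; apply: sPA.
Qed.

Lemma mulmxr_continuous m n (Q : 'M[R]_(m, n)) :
  continuous (fun x : 'rV[R]_m => x *m Q).
Proof.
apply: continuous_mx_entries => i j.
rewrite (_ : (fun x : 'rV[R]_m => (x *m Q) i j) =
             (fun x => \sum_k x i k * Q k j)); last first.
  by apply/funext => x; rewrite mxE.
apply: continuous_big => [|k _ x]; first exact: add_continuous.
apply: (@continuousM _ _ (fun y : 'rV[R]_m => y i k) (fun=> Q k j)).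
  exact: coord_continuous.
exact: cst_continuous.
Qed.

Lemma Ck_cst k m n (U : set 'rV[R]_m) (c : 'rV[R]_n) : Ck k U (fun=> c).
Proof.
elim: k c => [|k IHk] c /=; split=> //;
  try by move=> x _; exact: cst_continuous.
move=> i; split; first by move=> x _; apply: (derivable_cst c).
rewrite (_ : (fun x => 'D__ _ x) = (fun=> 0)); first exact: IHk.
by apply/funext => x; exact: derive_cst.
Qed.

(** The differential of a continuous linear map is the map itself, so every partial derivative is
    constant and [Ck_cst] settles all higher orders. *)
Lemma smooth_mulmxr m n (U : set 'rV[R]_m) (Q : 'M[R]_(m, n)) :
  smooth_on U (fun x => x *m Q).
Proof.
have cQ : continuous (mulmxr Q : 'rV[R]_m -> 'rV[R]_n).
  exact: mulmxr_continuous.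
case=> [|k] /=; split=> //; try by move=> x _; exact: mulmxr_continuous.
have dQ x : differentiable (mulmxr Q : 'rV[R]_m -> 'rV[R]_n) x.
  exact: linear_differentiable.
move=> i; split; first by move=> x _; apply: diff_derivable; exact: dQ.
rewrite (_ : (fun x => 'D__ _ x) = (fun=> delta_mx 0 i *m Q)).
  exact: Ck_cst.
by apply/funext => x; rewrite (deriveE _ (dQ x)) (diff_lin x cQ).
Qed.

(** Gaussian elimination factors [B] as an invertible matrix times [pid_mx d] times [row_ebase B].
    The left factor does not change the row space, and the inverse of the right one carries it to
    the span of the first [d] coordinate vectors. *)
Lemma row_free_slice d N (B : 'M[R]_(d, N)) : row_free B ->
  exists2 Q : 'M[R]_N, Q \in unitmx &
    forall x : 'rV[R]_N, (x <= B)%MS <-> coordinate_slice d (x *m Q).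
Proof.
move=> freeB; have rB : \rank B = d by apply/eqP.
exists (invmx (row_ebase B)); first by rewrite unitmx_inv row_ebase_unit.
have uR := row_ebase_unit B.
have eB : (B :=: (pid_mx d : 'M[R]_(d, N)) *m row_ebase B)%MS.
  rewrite -{1}(mulmx_ebase B) rB -mulmxA; apply: eqmxMfull.
  by rewrite row_full_unit col_ebase_unit.
move=> x; rewrite eB; split.
  case/submxP => y ->; rewrite -!mulmxA mulmxV // mulmx1 => i led.
  rewrite !mxE big1 // => k _; rewrite !mxE.
  by rewrite [_ == _]ltn_eqF ?mulr0 // (leq_trans (ltn_ord k)).
(* The witness keeps the first [d] entries of [y]; padding them with zeros gives back [y], whose
   other entries vanish by [sy]. *)
set y := x *m _ => sy; apply/submxP; exists (y *m (pid_mx d : 'M[R]_(N, d))).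
rewrite -[LHS](mulmxKV uR) [RHS]mulmxA; congr (_ *m _).
rewrite -/y -mulmxA mul_pid_mx !minnn; clearbody y.
apply/rowP => i; rewrite mxE (bigD1 i) //= mxE eqxx /= big1 ?addr0 => [|j ji].
  case: ltnP => [|le]; last by rewrite mulr0 sy.
  by rewrite mulr1.
by rewrite !mxE -[_ == _]/(j == i) (negPf ji) mulr0.
Qed.

(** One global linear map, right multiplication by the matrix [Q] straightening the row space of
    [B], gives all the charts; only its domain [U] depends on the point. *)
Lemma locally_linear_submanifold d N (W M : set 'rV[R]_N) (B : 'M[R]_(d, N)) :
    row_free B -> M `<=` W ->
    (forall x, M x -> exists U : set 'rV[R]_N,
       [/\ open U, U `<=` W, U x & forall y, U y -> M y <-> (y <= B)%MS]) ->
  embedded_submanifold W d M.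
Proof.
move=> freeB sMW locM; have [Q uQ sliceQ] := row_free_slice freeB.
split=> // [|x Mx]; first by rewrite -(eqP freeB) rank_leq_col.
have [U [oU sUW Ux MU]] := locM x Mx.
(* [V] is the image of [U] under the chart, written as a preimage under the inverse so that
   continuity makes it open. *)
pose V := (fun y : 'rV[R]_N => y *m invmx Q) @^-1` U.
exists U, V, (fun x => x *m Q); split=> //.
- by apply: open_comp => // y _; exact: mulmxr_continuous.
- split; first split.
  + by move=> y Uy; rewrite /V /= mulmxK.
  + by move=> y z _ _ /(congr1 (mulmxr (invmx Q))) /=; rewrite !mulmxK.
  + by move=> y Vy; exists (y *m invmx Q); rewrite // mulmxKV.
  + exact: smooth_mulmxr.
  + exists (fun y => y *m invmx Q); split; last exact: smooth_mulmxr.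
    by move=> y _; rewrite mulmxK.
- apply/seteqP; split=> [_ [y [Uy My] <-]|y [Vy Sy]].
    by split; [rewrite /V /= mulmxK | apply/sliceQ/MU].
  exists (y *m invmx Q); rewrite ?mulmxKV //; split=> //.
  by apply/MU => //; apply/sliceQ; rewrite mulmxKV.
Qed.

End LinearCharts.

(** * Linear algebra over an arbitrary field: subspaces as images and kernels *)

Section MatricesOfSubspaces.
Variables (F : fieldType) (n : nat).
Implicit Type S : {vspace 'cV[F]_n}.

(** The columns of [B] are a basis of [S]; their independence provides the left inverse [L], which
    reads off coordinates in that basis. *)
Lemma vspace_imageP S : exists (B : 'M[F]_(n, \dim S)) (L : 'M[F]_(\dim S, n)),
  L *m B = 1%:M /\ forall v, v \in S <-> exists w, v = B *m w.
Proof.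
pose B : 'M[F]_(n, \dim S) := \matrix_(i, j) (vbasis S)`_j i 0.
have BE w : B *m w = \sum_j w j 0 *: (vbasis S)`_j.
  apply/colP => i; rewrite mxE summxE; apply: eq_bigr => j _.
  by rewrite !mxE mulrC.
have freeB : row_free B^T.
  apply: inj_row_free => v vB0; apply/rowP => j; rewrite mxE.
  have/freeP := basis_free (vbasisP S); apply.
  have -> : \sum_i v 0 i *: (vbasis S)`_i = B *m v^T.
    by rewrite BE; apply: eq_bigr => i _; rewrite mxE.
  by apply: trmx_inj; rewrite trmx_mul trmxK vB0 trmx0.
have [L' BL'] := row_freeP freeB.
exists B, L'^T; split=> [|v].
  by apply: trmx_inj; rewrite trmx_mul trmxK trmx1.
split=> [vS|[w ->]].
  exists (\col_j coord (vbasis S) j v).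
  by rewrite BE {1}(coord_vbasis vS); apply: eq_bigr => j _; rewrite mxE.
rewrite BE; apply: memv_suml => j _; apply: memvZ; apply: vbasis_mem.
by rewrite mem_nth // size_tuple.
Qed.

(** The cokernel matrix [K] of [B^T] annihilates exactly the transposes of vectors of [S]. Its
    columns may be dependent, so [C] is the transpose of a column basis of [K], whose independence
    provides [C']. *)
Lemma vspace_kernelP S : exists r (C : 'M[F]_(r, n)) (C' : 'M[F]_(n, r)),
  [/\ r = (n - \dim S)%N, C *m C' = 1%:M & forall v, v \in S <-> C *m v = 0].
Proof.
have [B [L [LB SB]]] := vspace_imageP S.
have freeB : row_free B^T.
  by apply/row_freeP; exists L^T; rewrite -trmx_mul LB trmx1.
pose K := cokermx B^T.
have : row_free (col_base K)^T.
  by rewrite /row_free mxrank_tr; exact: col_base_full.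
case/row_freeP => C' KC'; exists (\rank K), (col_base K)^T, C'; split=> //.
  by rewrite mxrank_coker (eqP freeB).
move=> v.
have -> : ((col_base K)^T *m v = 0) <-> (v^T <= B^T)%MS.
  have vK : v^T *m K = v^T *m col_base K *m row_base K.
    by rewrite -mulmxA mulmx_base.
  rewrite submxE -/K vK mulmx_free_eq0 ?row_base_free //.
  rewrite -trmx_eq0 [X in X == 0]trmx_mul trmxK.
  by split=> [->|/eqP].
rewrite SB; split=> [[w ->]|/submxP[w vw]].
  by rewrite trmx_mul submxMl.
by exists w^T; apply: trmx_inj; rewrite trmx_mul trmxK.
Qed.

Lemma mx_imageP (A : 'M[F]_n) S v :
  v \in mx_image A S <-> exists2 u, u \in S & v = A *m u.
Proof.
split=> [/memv_imgP[u uS ->]|[u uS ->]].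
  by exists u; rewrite // lfunE.
by apply/memv_imgP; exists u; rewrite // lfunE.
Qed.

(** On [S] the two maps differ by a multiple of the identity, which the summand [S] absorbs. *)
Lemma Mset_shift S S' (A : 'M[F]_n) (c : F) :
  Mset S S' A -> Mset S S' (A - c%:M).
Proof.
rewrite /Mset /= => <-; apply/eqP; rewrite eqEsubv; apply/andP; split.
  rewrite subv_add addvSl /=; apply/subvP => _ /mx_imageP[u uS ->].
  rewrite mulmxBl mul_scalar_mx addrC; apply: memv_add.
    by rewrite memvN memvZ.
  by apply/mx_imageP; exists u.
rewrite subv_add addvSl /=; apply/subvP => _ /mx_imageP[u uS ->].
have -> : A *m u = c *: u + (A - c%:M) *m u.
  by rewrite mulmxBl mul_scalar_mx addrC subrK.
apply: memv_add.
  by rewrite memvZ.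
by apply/mx_imageP; exists u.
Qed.

(* The open condition is expressed by the non-vanishing of one fixed maximal
   minor of [B, AB], taken in coordinates where it equals 1 at A0. *)
Lemma Mset_locally S S' (hSS' : (S <= S')%VS) :
  exists r (C : 'M[F]_(r, n)) (C' : 'M[F]_(n, r)) (B : 'M[F]_(n, \dim S))
         (L : 'M[F]_(\dim S, n)),
  [/\ r = (n - \dim S')%N, C *m C' = 1%:M, L *m B = 1%:M &
    forall A0, Mset S S' A0 ->
    exists k (X : 'M[F]_(k, n)) (Y : 'M[F]_(\dim S + \dim S, k)),
      X *m row_mx B (A0 *m B) *m Y = 1%:M /\
      forall A, X *m row_mx B (A *m B) *m Y \in unitmx ->
        Mset S S' A <-> C *m A *m B = 0].
Proof.
have [r [C [C' [rE CC' kerC]]]] := vspace_kernelP S'.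
have [B [L [LB imB]]] := vspace_imageP S.
have [B' [L' [LB' imB']]] := vspace_imageP S'.
exists r, C, C', B, L; split=> // A0 MA0.
have addP A v : v \in (S + mx_image A S)%VS <->
    exists w, v = row_mx B (A *m B) *m w.
  split=> [/memv_addP[u /imB[w1 ->] [_ /mx_imageP[u' /imB[w2 ->] ->] ->]]|].
    by exists (col_mx w1 w2); rewrite mul_row_col mulmxA.
  case=> w ->; rewrite -[w]vsubmxK mul_row_col -mulmxA; apply: memv_add.
    by apply/imB; eexists.
  by apply/mx_imageP; eexists; last reflexivity; apply/imB; eexists.
(* The columns of [[B, A0 B]] span [S'], so each column of the basis matrix [B'] is a combination of
   them. With [X := L'] the product at [A0] is then [L' *m B'], the identity. *)
have [Y YE] : exists Y, row_mx B (A0 *m B) *m Y = B'.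
  have /(_ _)/cid col_ex j : exists w, col j B' = row_mx B (A0 *m B) *m w.
    apply/addP; rewrite MA0; apply/imB'; exists (delta_mx j 0).
    by rewrite colE.
  exists (\matrix_(i, j) (sval (col_ex j)) i 0).
  apply/matrixP => i j; have /colP/(_ i) := svalP (col_ex j).
  by rewrite !mxE => ->; apply: eq_bigr => k _; rewrite !mxE.
exists (\dim S'), L', Y; split; first by rewrite -mulmxA YE.
move=> A uG; set T := row_mx B (A *m B) in uG *.
split=> [MA|CAB0].
  apply/matrixP => i j; rewrite [RHS]mxE.
  suff /colP/(_ i) : C *m (A *m col j B) = 0.
    by rewrite colE !mulmxA -colE mxE [RHS]mxE.
  apply/kerC; rewrite -MA; apply: (subvP (addvSr _ _)).
  apply/mx_imageP; exists (col j B) => //.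
  by apply/imB; exists (delta_mx j 0); rewrite colE.
have sub : (S + mx_image A S <= S')%VS.
  rewrite subv_add hSS' /=; apply/subvP => _ /mx_imageP[u /imB[w ->] ->].
  by apply/kerC; rewrite !mulmxA CAB0 mul0mx.
apply/eqP; rewrite eqEsubv sub /=; apply/subvP => v /imB'[w ->].
(* The columns of [Z] lie in [S + A S], hence in [S'], and [L'] sends [Z] to the identity. Since
   [L'] is injective on [S'], [Z *m w] must be [B' *m w], which puts every vector of [S'] in
   [S + A S]. *)
pose Z := T *m Y *m invmx (L' *m T *m Y).
have LZ : L' *m Z = 1%:M by rewrite /Z !mulmxA mulmxV.
have ZwT : Z *m w = T *m (Y *m invmx (L' *m T *m Y) *m w).
  by rewrite /Z -!mulmxA.
have /imB'[w' Zw] : Z *m w \in S'.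
  by apply: (subvP sub); apply/addP; exists (Y *m invmx (L' *m T *m Y) *m w).
suff -> : w = w' by rewrite -Zw ZwT; apply/addP; eexists.
by rewrite -[LHS]mul1mx -LZ -mulmxA Zw mulmxA LB' mul1mx.
Qed.

(** The map sending [A] to [C A B] is onto, since [D = C (C' D L) B] for every [D]; rank-nullity
    then gives the dimension of its kernel. *)
Lemma sandwich_kernel r p (C : 'M[F]_(r, n)) (C' : 'M[F]_(n, r))
    (B : 'M[F]_(n, p)) (L : 'M[F]_(p, n)) :
    C *m C' = 1%:M -> L *m B = 1%:M ->
  exists d (K : 'M[F]_(d, n * n)), [/\ d = (n * n - r * p)%N, row_free K &
    forall A : 'M[F]_n, (mxvec A <= K)%MS <-> C *m A *m B = 0].
Proof.
move=> CC' LB; pose f := lin_mx (mulmxr B \o mulmx C : 'M[F]_n -> 'M[F]_(r, p)).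
have fE (A : 'M[F]_n) : mxvec A *m f = mxvec (C *m A *m B).
  by rewrite mul_rV_lin mxvecK.
exists (\rank (kermx f)), (row_base (kermx f)); split.
- rewrite mxrank_ker; congr (_ - _)%N; apply/eqP; apply/row_fullP.
  exists (lin_mx (mulmxr L \o mulmx C' : 'M[F]_(r, p) -> 'M[F]_n)).
  apply/row_matrixP => i; rewrite !rowE mulmx1 mulmxA.
  rewrite [X in X *m f]mul_rV_lin fE /=.
  by rewrite !mulmxA CC' mul1mx -mulmxA LB mulmx1 vec_mxK.
- exact: row_base_free.
move=> A; rewrite eq_row_base; split=> [/sub_kermxP|CAB0].
  by rewrite fE => /(canRL mxvecK); rewrite linear0.
by apply/sub_kermxP; rewrite fE CAB0 linear0.
Qed.

End MatricesOfSubspaces.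

(** * Real and imaginary parts, and continuity over the ground field *)

Section GroundField.
Variables (R : realType) (g : ground).
Local Notation F := (ground_field R g).

Definition ground_re : F -> R :=
  match g return ground_field R g -> R with
  | RealField => id
  | ComplexField => @complex.Re R
  end.

(** Being zero in the real case, it lets the complex product formulas hold for both fields. *)
Definition ground_im : F -> R :=
  match g return ground_field R g -> R with
  | RealField => fun=> 0
  | ComplexField => @complex.Im R
  end.

Definition of_real : R -> F :=
  match g return R -> ground_field R g with
  | RealField => id
  | ComplexField => real_complex R
  end.

Lemma ground_reD x y : ground_re (x + y) = ground_re x + ground_re y.
Proof. by rewrite /ground_re; case: g x y => //= - [? ?] [? ?]. Qed.

Lemma ground_imD x y : ground_im (x + y) = ground_im x + ground_im y.
Proof.
by rewrite /ground_im; case: g x y => /= [x y|[? ?] [? ?] //]; rewrite addr0.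
Qed.

Lemma ground_reM x y :
  ground_re (x * y) = ground_re x * ground_re y - ground_im x * ground_im y.
Proof.
rewrite /ground_re /ground_im.
by case: g x y => /= [x y|[? ?] [? ?] //]; rewrite mul0r subr0.
Qed.

Lemma ground_imM x y :
  ground_im (x * y) = ground_re x * ground_im y + ground_im x * ground_re y.
Proof.
rewrite /ground_re /ground_im.
by case: g x y => /= [x y|[? ?] [? ?] //]; rewrite mul0r mulr0 addr0.
Qed.

Lemma ground_eq0 x : (x == 0) = (ground_re x == 0) && (ground_im x == 0).
Proof.
rewrite /ground_re /ground_im.
by case: g x => /= [x|[a b]]; rewrite ?eqxx ?andbT // eq_complex.
Qed.

Lemma of_real_inj : injective of_real.
Proof. by rewrite /of_real; case: g => // x y []. Qed.

Section Continuity.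
Variable T : topologicalType.

(** [ground_field] carries only a field structure, so Euclidean continuity is expressed through
    real-valued functions, uniformly in both cases. *)
Definition ground_continuous (f : T -> F) :=
  continuous (ground_re \o f) /\ continuous (ground_im \o f).

Lemma ground_continuous_cst c : ground_continuous (fun=> c).
Proof. by split=> x; exact: cst_continuous. Qed.

Lemma ground_continuousD f h : ground_continuous f -> ground_continuous h ->
  ground_continuous (fun x => f x + h x).
Proof.
move=> [cf cf'] [ch ch']; split=> x.
  rewrite (_ : _ \o _ = (ground_re \o f) \+ (ground_re \o h)).
    by apply: continuousD; [exact: cf | exact: ch].
  by apply/funext => y; rewrite /= ground_reD.
rewrite (_ : _ \o _ = (ground_im \o f) \+ (ground_im \o h)).
  by apply: continuousD; [exact: cf' | exact: ch'].
by apply/funext => y; rewrite /= ground_imD.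
Qed.

Lemma ground_continuousM f h : ground_continuous f -> ground_continuous h ->
  ground_continuous (fun x => f x * h x).
Proof.
move=> [cf cf'] [ch ch']; split=> x.
  rewrite (_ : _ \o _ = ((ground_re \o f) \* (ground_re \o h)) \-
                        ((ground_im \o f) \* (ground_im \o h))).
    by apply: continuousB; apply: continuousM;
      [exact: cf | exact: ch | exact: cf' | exact: ch'].
  by apply/funext => y; rewrite /= ground_reM.
rewrite (_ : _ \o _ = ((ground_re \o f) \* (ground_im \o h)) \+
                      ((ground_im \o f) \* (ground_re \o h))).
  by apply: continuousD; apply: continuousM;
    [exact: cf | exact: ch' | exact: cf' | exact: ch].
by apply/funext => y; rewrite /= ground_imM.
Qed.

Lemma ground_continuous_sum (I : finType) (f : I -> T -> F) :
  (forall i, ground_continuous (f i)) ->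
  ground_continuous (fun x => \sum_i f i x).
Proof.
move=> cf; rewrite unlock; elim: (index_enum I) => [|i s IHs] /=.
  exact: ground_continuous_cst.
exact: ground_continuousD.
Qed.

Lemma ground_continuous_prod (I : finType) (f : I -> T -> F) :
  (forall i, ground_continuous (f i)) ->
  ground_continuous (fun x => \prod_i f i x).
Proof.
move=> cf; rewrite unlock; elim: (index_enum I) => [|i s IHs] /=.
  exact: ground_continuous_cst.
exact: ground_continuousM.
Qed.

Definition mx_continuous m n (f : T -> 'M[F]_(m, n)) :=
  forall i j, ground_continuous (fun x => f x i j).

Lemma mx_continuous_cst m n (A : 'M[F]_(m, n)) : mx_continuous (fun=> A).
Proof. by move=> i j; exact: ground_continuous_cst. Qed.

Lemma mx_continuousM m n k (f : T -> 'M[F]_(m, n)) (h : T -> 'M[F]_(n, k)) :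
  mx_continuous f -> mx_continuous h -> mx_continuous (fun x => f x *m h x).
Proof.
move=> cf ch i j.
rewrite (_ : (fun x => _) = fun x => \sum_k f x i k * h x k j).
  by apply: ground_continuous_sum => l; exact: ground_continuousM.
by apply/funext => x; rewrite mxE.
Qed.

Lemma mx_continuous_row_mx m n k (f : T -> 'M[F]_(m, n))
    (h : T -> 'M[F]_(m, k)) :
  mx_continuous f -> mx_continuous h ->
  mx_continuous (fun x => row_mx (f x) (h x)).
Proof.
move=> cf ch i j; case: (split_ordP j) => l ->.
  by under [X in ground_continuous X]eq_fun do rewrite row_mxEl; exact: cf.
by under [X in ground_continuous X]eq_fun do rewrite row_mxEr; exact: ch.
Qed.

(** The determinant is a polynomial in the entries, hence continuous, and it is nonzero exactly
    where its real or imaginary part is. *)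
Lemma open_unitmx_preimage n (f : T -> 'M[F]_n) :
  mx_continuous f -> open [set x | f x \in unitmx].
Proof.
move=> cf.
have [cre cim] : ground_continuous (fun x => \det (f x)).
  apply: ground_continuous_sum => s; apply: ground_continuousM.
    exact: ground_continuous_cst.
  by apply: ground_continuous_prod => i; exact: cf.
rewrite (_ : [set x | _] =
    (ground_re \o (fun x => \det (f x))) @^-1` [set~ 0] `|`
    (ground_im \o (fun x => \det (f x))) @^-1` [set~ 0]).
  by apply: openU; apply: open_comp => //; apply: closed_openC;
    exact: closed_eq.
apply/seteqP; split=> x; rewrite /= unitmxE unitfE ground_eq0 negb_and.
  by move=> /orP[] /eqP; [left | right].
by move=> [] /eqP ->; rewrite ?orbT.
Qed.

End Continuity.

(** * Real coordinates of matrices over the ground field *)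

Section Coordinates.
Variable n : nat.
Local Notation N := (real_size g n).

Definition of_real_coords : 'rV[R]_N -> 'M[F]_n :=
  match g return 'rV[R]_(real_size g n) -> 'M[ground_field R g]_n with
  | RealField => vec_mx
  | ComplexField => fun x => \matrix_(i, j)
      Complex (vec_mx (lsubmx x) i j) (vec_mx (rsubmx x) i j)
  end.

Lemma real_coordsK : cancel (@real_coords R g n) of_real_coords.
Proof.
rewrite /of_real_coords; case: g => /= A; first exact: mxvecK.
rewrite row_mxKl row_mxKr !mxvecK; apply/matrixP => i j.
by rewrite !mxE; case: (A i j).
Qed.

Lemma of_real_coordsK : cancel of_real_coords (@real_coords R g n).
Proof.
rewrite /of_real_coords; case: g => /= x; first exact: vec_mxK.
rewrite -[RHS]hsubmxK; congr row_mx; rewrite -[RHS]vec_mxK; congr mxvec;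
  by apply/matrixP => i j; rewrite !mxE.
Qed.

Lemma of_real_coords_continuous : mx_continuous of_real_coords.
Proof.
rewrite /mx_continuous /ground_continuous /ground_re /ground_im /of_real_coords.
case: g => /= i j; split => /=.
- under [X in continuous X]eq_fun do rewrite mxE.
  exact: coord_continuous.
- by move=> x; exact: cst_continuous.
- under [X in continuous X]eq_fun do rewrite /= !mxE /=.
  exact: coord_continuous.
- under [X in continuous X]eq_fun do rewrite /= !mxE /=.
  exact: coord_continuous.
Qed.

(** In coordinates the real shifts of [A] form an affine line, which makes their convergence to [A]
    immediate in the density argument. *)
Lemma real_coords_shift (A : 'M[F]_n) (t : R) :
  real_coords (A - (of_real t)%:M) =
  real_coords A - t *: real_coords (1%:M : 'M[F]_n).
Proof.
rewrite /of_real; case: g A => /= A.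
  by rewrite linearB /= -linearZ scalemx1.
rewrite scale_row_mx opp_row_mx add_row_mx -!linearZ -!linearB /=.
congr row_mx; congr mxvec; apply/matrixP => i j; rewrite !mxE.
  by case: (A i j) => a b; case: eqP => _;
    rewrite ?mulr1n ?mulr0n /= ?mulr1 ?mulr0.
by case: (A i j) => a b; case: eqP => _;
    rewrite ?mulr1n ?mulr0n /= ?mulr1 ?mulr0.
Qed.

Lemma real_coords_imageP (X : set 'M[F]_n) x :
  (real_coords @` X) x <-> X (of_real_coords x).
Proof.
split=> [[A XA <-]|Xx]; first by rewrite real_coordsK.
by exists (of_real_coords x); rewrite // of_real_coordsK.
Qed.

End Coordinates.
End GroundField.

(** * Real form of complex row spaces, and invertible shifts near zero *)

Lemma complex_row_space (R : realType) d m (B : 'M[R[i]]_(d, m)) :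
  row_free B ->
  exists2 BR : 'M[R]_(d + d, m + m), row_free BR &
    forall v : 'rV[R[i]]_m,
      (row_mx (map_mx (@complex.Re R) v) (map_mx (@complex.Im R) v)
         <= BR)%MS <->
      (v <= B)%MS.
Proof.
move=> freeB.
pose re k l := map_mx (@complex.Re R) : 'M[R[i]]_(k, l) -> 'M[R]_(k, l).
pose im k l := map_mx (@complex.Im R) : 'M[R[i]]_(k, l) -> 'M[R]_(k, l).
(* The rows of [BR] are the real coordinates of the rows of [B] and of their multiples by the
   imaginary unit, so real combinations of the former are complex combinations of the rows of
   [B]. *)
pose BR := block_mx (re _ _ B) (im _ _ B) (- im _ _ B) (re _ _ B).
have BRE (c : 'rV[R[i]]_d) :
    row_mx (re _ _ c) (im _ _ c) *m BR =
    row_mx (re _ _ (c *m B)) (im _ _ (c *m B)).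
  rewrite mul_row_block; congr row_mx; apply/rowP => j; rewrite !mxE.
    rewrite raddf_sum -big_split; apply: eq_bigr => k _; rewrite !mxE.
    by case: (c 0 k) (B k j) => a b [a' b'] /=; rewrite mulrN.
  rewrite raddf_sum -big_split; apply: eq_bigr => k _; rewrite !mxE.
  by case: (c 0 k) (B k j) => a b [a' b'] /=.
have cplx k (x : 'rV[R]_(k + k)) :
    exists c : 'rV[R[i]]_k, x = row_mx (re _ _ c) (im _ _ c).
  exists (\row_j Complex (x 0 (lshift k j)) (x 0 (rshift k j))).
  rewrite -[LHS]hsubmxK; congr row_mx; apply/rowP => j;
    by rewrite !mxE.
have reim_inj k (c c' : 'rV[R[i]]_k) :
    row_mx (re _ _ c) (im _ _ c) = row_mx (re _ _ c') (im _ _ c') -> c = c'.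
  move=> /eq_row_mx[/rowP ere /rowP eim]; apply/rowP => j.
  move: (ere j) (eim j); rewrite !mxE.
  by case: (c 0 j) (c' 0 j) => a b [a' b'] /= -> ->.
exists BR.
  apply: inj_row_free => x; have [c ->] := cplx _ x; rewrite BRE => cB0.
  have cB : c *m B = 0.
    by apply: reim_inj; rewrite cB0 /re /im !map_mx0 row_mx0.
  have -> : c = 0 by apply/eqP; rewrite -(mulmx_free_eq0 _ freeB) cB.
  by rewrite /re /im !map_mx0 row_mx0.
move=> v; split=> [/submxP[x]|/submxP[c ->]]; last first.
  by rewrite -/(re _ _ _) -/(im _ _ _) -BRE submxMl.
have [c ->] := cplx _ x; rewrite BRE => /reim_inj ->.
exact: submxMl.
Qed.

Lemma real_row_space (R : realType) (g : ground) n d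
    (B : 'M[ground_field R g]_(d, n * n)) : row_free B ->
  exists d' (BR : 'M[R]_(d', real_size g n)),
    [/\ d' = (alpha g * d)%N, row_free BR &
      forall A : 'M[ground_field R g]_n,
        (real_coords A <= BR)%MS <-> (mxvec A <= B)%MS].
Proof.
case: g B => /= B freeB; first by exists d, B; rewrite mul1n.
have [BR freeBR BRE] := complex_row_space freeB.
exists (d + d)%N, BR; split=> // [|A]; first by rewrite mul2n addnn.
by rewrite -BRE !map_mxvec.
Qed.

(** Among sufficiently many distinct reals in the interval, one is not an eigenvalue of [A]. *)
Lemma unitmx_shift_near0 (R : realType) (g : ground) n
    (A : 'M[ground_field R g]_n) (e : R) : 0 < e ->
  exists2 t : R, 0 < t < e & A - (of_real g t)%:M \in unitmx.
Proof.
(* The denominator starts at 2, so that [t 0] is already strictly below [e]. *)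
move=> e0; pose t k : R := e / k.+2%:R.
have t_bnd k : 0 < t k < e.
  by rewrite divr_gt0 //= ltr_pdivrMr // ltr_pMr // ltr1n.
have t_inj : injective t.
  move=> j k /(mulfI (lt0r_neq0 e0)) /invr_inj /eqP.
  by rewrite eqr_nat => /eqP [].
(* The size of a polynomial is its degree plus one, so these distinct candidates outnumber the
   possible roots. *)
pose ts := [seq of_real g (t k) | k <- iota 0 (size (char_poly A))].
have : ~~ all (root (char_poly A)) ts.
  apply/negP => /(max_poly_roots (monic_neq0 (char_poly_monic A))).
  rewrite map_inj_uniq ?iota_uniq ?size_map ?size_iota ?ltnn.
    by move/(_ isT).
  by move=> j k /of_real_inj /t_inj.
rewrite -has_predC => /hasP[_ /mapP[k _ ->]] /=.
rewrite -eigenvalue_root_char /eigenvalue negbK => /eqP keig.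
exists (t k) => //.
by rewrite -row_free_unit -kermx_eq0 -[kermx _]/(eigenspace A _) keig.
Qed.

Theorem corollary5p10 (R : realType) (g : ground) (n : nat) (hn : (1 <= n)%N)
    (S S' : {vspace 'cV[ground_field R g]_n}) (hSS' : (S <= S')%VS)
    (p q : nat) (hp : p = \dim S) (hq : q = (\dim S' - \dim S)%N)
    (hqp : (q <= p)%N) :
  embedded_submanifold
    (real_coords @` (GL : set 'M[ground_field R g]_n))
    (alpha g * (n ^ 2 - p * (n - p - q)))%N
    (real_coords @` Minv S S') /\
  open_subset_of (real_coords @` Mset S S')
                 (real_coords @` Minv S S') /\
  dense_subset_of (real_coords @` Mset S S')
                  (real_coords @` Minv S S').
Proof.
set W := real_coords @` GL.
have oW : open W.
  rewrite (_ : W = [set x | of_real_coords x \in unitmx]).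
    by apply: open_unitmx_preimage; exact: of_real_coords_continuous.
  by apply/funext => x; apply/propext; exact: real_coords_imageP.
split; last split.
- have [r [C [C' [B [L [rE CC' LB locM]]]]]] := Mset_locally hSS'.
  have [d [K [dE freeK KE]]] := sandwich_kernel CC' LB.
  have [d' [KR [d'E freeKR KRE]]] := real_row_space freeK.
  (* The inclusion of [S] in [S'] makes the truncated subtraction in [q] exact, so [p + q] is
     [\dim S'] and [n - p - q] is [r]. *)
  have -> : (alpha g * (n ^ 2 - p * (n - p - q)))%N = d'.
    rewrite d'E dE rE hp hq -mulnn -subnDA subnKC ?dimvS //.
    by rewrite (mulnC (\dim S)).
  apply: locally_linear_submanifold freeKR _ _ => [|x].
    by apply: image_subset => A [].
  move=> /real_coords_imageP[Mx uGx]; have [k [X [Y [XY MX]]]] := locM _ Mx.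
  pose f (y : 'rV[R]_(real_size g n)) :=
    X *m row_mx B (of_real_coords y *m B) *m Y.
  have cf : mx_continuous f.
    apply: mx_continuousM; last exact: mx_continuous_cst.
    apply: mx_continuousM; first exact: mx_continuous_cst.
    apply: mx_continuous_row_mx; first exact: mx_continuous_cst.
    apply: mx_continuousM; last exact: mx_continuous_cst.
    exact: of_real_coords_continuous.
  (* On this neighbourhood invertibility of the matrix is automatic and the chosen minor does not
     vanish, so membership in [Minv] reduces to the linear equation [C A B = 0]. *)
  exists (W `&` [set y | f y \in unitmx]); split.
  + exact/openI/open_unitmx_preimage.
  + by move=> y [].
  + by split; [exact/real_coords_imageP | rewrite /= /f XY unitmx1].
  + move=> y [/real_coords_imageP uGy fy].
    rewrite -[y in (y <= _)%MS]of_real_coordsK KRE KE -MX //.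
    by rewrite real_coords_imageP; split=> [[]|].
- exists W => //; apply/seteqP; split=> x.
    by move=> /real_coords_imageP[? ?]; split; exact/real_coords_imageP.
  move=> [/real_coords_imageP ? /real_coords_imageP ?].
  exact/real_coords_imageP.
- split=> [|_ [A MA <-] V]; first by apply: image_subset => A [].
  set u := real_coords (1%:M : 'M[ground_field R g]_n).
  (* A neighbourhood [V] of [A] contains [A - t I] for all small [t], and arbitrarily small positive
     [t] make it invertible. *)
  have ct : (fun t : R => real_coords A - t *: u) @ (0 : R) --> real_coords A.
    rewrite -[X in _ --> X]subr0 -[X in _ - X](scale0r u).
    by apply: cvgB; [exact: cvg_cst | apply: cvgZl; exact: cvg_id].
  move=> /ct /nbhs_ballP[e /= e0 eV].
  have [t /andP[t0 te] ut] := unitmx_shift_near0 A e0.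
  exists (real_coords (A - (of_real g t)%:M)); split.
    by exists (A - (of_real g t)%:M) => //; split; first exact: Mset_shift.
  rewrite real_coords_shift; apply: eV.
  by rewrite /ball /= sub0r normrN gtr0_norm.
Qed.
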